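(* For every $n\ge1$, the left and right global dimensions of $\mathbb{S}_n$ are both equal to $n$: $\mathrm{l.gldim}(\mathbb{S}_n)=\mathrm{r.gldim}(\mathbb{S}_n)=n$.
   Context: $K$ is a field. $\mathbb{S}_n$ is the $K$-algebra generated by $x_1,\dots,x_n,y_1,\dots,y_n$ subject to the defining relations $y_ix_i=1$ for all $i$, and $[x_i,y_j]=[x_i,x_j]=[y_i,y_j]=0$ for all $i\ne j$. *)

(* Defs.v *)
From HB Require Import structures.
From mathcomp Require Import all_boot all_order all_algebra.
Set Implicit Arguments. Unset Strict Implicit. Unset Printing Implicit Defensive.
Import GRing.Theory.
Local Open Scope ring_scope.

Definition is_alg_hom (K : fieldType) (A B : algType K) (f : A -> B) : Prop :=
  [/\ (forall u v, f (u + v) = f u + f v),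
      (forall u v, f (u * v) = f u * f v),
      f 1 = 1 &
      (forall (k : K) u, f (k *: u) = k *: f u)].

Definition Sn_relations (K : fieldType) (n : nat) (B : algType K)
    (x y : 'I_n -> B) : Prop :=
  (forall i, y i * x i = 1) /\
  (forall i j, i != j ->
     [/\ x i * y j = y j * x i,
         x i * x j = x j * x i &
         y i * y j = y j * y i]).

(* (A, x, y) is the K-algebra generated by x_1..x_n, y_1..y_n subject to the
   defining relations of S_n, i.e. it satisfies the universal property of the
   presentation: the relations hold in A, and for every K-algebra B with
   elements a, b satisfying the relations there is a unique K-algebra
   homomorphism A -> B sending x_i |-> a_i, y_i |-> b_i. *)
Definition is_Sn (K : fieldType) (n : nat) (A : algType K)
    (x y : 'I_n -> A) : Prop :=
  Sn_relations x y /\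
  forall (B : algType K) (a b : 'I_n -> B), Sn_relations a b ->
    (exists f : A -> B, is_alg_hom f /\
        (forall i, f (x i) = a i) /\ (forall i, f (y i) = b i)) /\
    (forall f g : A -> B, is_alg_hom f -> is_alg_hom g ->
        (forall i, f (x i) = g (x i)) -> (forall i, f (y i) = g (y i)) ->
        forall u, f u = g u).

Section Homological.
Variable R : pzRingType.

Definition projective_mod (P : lmodType R) : Prop :=
  forall (M N : lmodType R) (g : {linear M -> N}) (h : {linear P -> N}),
    (forall v : N, exists u : M, g u = v) ->
    exists h' : {linear P -> M}, forall p, g (h' p) = h p.

(* pd M <= d : M has a projective resolution
   0 -> P_d -> ... -> P_1 -> P_0 -> M -> 0
   (encoded as an exact complex ... -> P_1 -> P_0 -> M -> 0 with P_k = 0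
   for k > d). *)
Definition pdim_le (M : lmodType R) (d : nat) : Prop :=
  exists (P : nat -> lmodType R) (dd : forall k, {linear P k.+1 -> P k})
         (eps : {linear P 0%N -> M}),
    [/\ (forall k, projective_mod (P k)),
        (forall k, (d < k)%N -> forall p : P k, p = 0),
        (forall m : M, exists p, eps p = m),
        (forall p : P 0%N, eps p = 0 <-> exists q, dd 0%N q = p) &
        (forall k (p : P k.+1), dd k p = 0 <-> exists q, dd k.+1 q = p)].

Definition gldim_le (d : nat) : Prop := forall M : lmodType R, pdim_le M d.

Definition gldim_eq (d : nat) : Prop :=
  gldim_le d /\ forall d', gldim_le d' -> (d <= d')%N.

End Homological.

(* left global dimension: via left modules over A;
   right global dimension: right A-modules = left modules over A^c *)
Definition l_gldim_eq (R : pzRingType) (d : nat) := gldim_eq R d.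
Definition r_gldim_eq (R : pzRingType) (d : nat) := gldim_eq R^c d.

(* Main.v *)
Require Import Defs.
From HB Require Import structures.
From mathcomp Require Import all_boot all_order all_algebra.
From mathcomp Require Import boolp classical_sets functions.
From mathcomp Require Import finmap.
From mathcomp Require monalg.
Set Implicit Arguments. Unset Strict Implicit. Unset Printing Implicit Defensive.
Import GRing.Theory.
Local Open Scope ring_scope.

(** S_n is the tensor power of n copies of S_1 = K<x, y | y x = 1>, so an
S_n-module is a K-space with n commuting pairs of operators, and the operators
can be forgotten one pair at a time. The coinduction functor, right adjoint to
the forgetful functor, consists of functions on the basis x^i y^j of S_1; it is
exact, hence restriction preserves projectives.

Upper bound: if M is an S_(k+1)-module that is projective over S_k, then an
extension of M by N is M * N with the action of the last pair twisted by a
cocycle, i.e. a pair (al, be) of S_k-maps with y al + be x = 0. Cocycles lift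
along epimorphisms of N, so Ext^2(M, -) vanishes and syzygies of M are
projective over S_(k+1). Every vector space being projective over S_0 = K, the
n-th syzygies of an S_n-module are projective.

Lower bound: on a projective S_(k+1)-module Z, every S_k-map from Z factors
through y - 1. On a resolution of the trivial module K (all generators act as
1), y - 1 is null-homotopic over S_k, and the homotopy and the factorization
together split off one step of the resolution. So the projective dimension of K
drops by at least one at each restriction, and K is not projective over S_1.

The opposite algebra of S_n is S_n with x and y exchanged. *)

Lemma linear_morphism (R : pzRingType) (U V : lmodType R) (f : U -> V) : linear f ->
  [/\ f 0 = 0, (forall u v, f (u + v) = f u + f v),
      (forall u v, f (u - v) = f u - f v) & (forall a u, f (a *: u) = a *: f u)].
Proof.
move=> lf.
have fB u v : f (u - v) = f u - f v.
  by have := lf (-1) v u; rewrite !scaleN1r (addrC _ u) => ->; rewrite addrC.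
have f0 : f 0 = 0 by rewrite -(subrr 0) fB subrr.
have fD u v : f (u + v) = f u + f v by have := lf 1 u v; rewrite !scale1r.
by split=> // a u; have := lf a u 0; rewrite f0 !addr0.
Qed.

(** * Spaces with operators *)

Section Reps.
Variable K : fieldType.

(* For each [k], the operators of index less than [k] make the space an
   S_k-module when [is_rep k] holds; [hom k] and [kproj k] ignore the others. *)
Record rep := Rep {
  rep_sort :> lmodType K;
  opx : nat -> rep_sort -> rep_sort;
  opy : nat -> rep_sort -> rep_sort }.

Definition hom (k : nat) (M N : rep) (f : M -> N) : Prop :=
  linear f /\ forall i, (i < k)%N ->
    (forall v, f (opx i v) = opx i (f v)) /\
    (forall v, f (opy i v) = opy i (f v)).

(* Requiring the operators of index [i] to be [hom i] encodes the commutation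
   relations between distinct indices, and the linearity of the operators. *)
Definition is_rep (k : nat) (M : rep) : Prop :=
  forall i, (i < k)%N ->
    [/\ hom i (@opx M i), hom i (@opy M i) & cancel (@opx M i) (opy i)].

Definition surj (M N : Type) (f : M -> N) := forall v, exists u, f u = v.

Definition kproj (k : nat) (P : rep) : Prop :=
  forall (M N : rep) (g : M -> N) (h : P -> N), is_rep k M -> is_rep k N ->
    hom k g -> surj g -> hom k h ->
    exists h' : P -> M, hom k h' /\ forall v, g (h' v) = h v.

Definition ses (k : nat) (Z P M : rep) (j : Z -> P) (f : P -> M) : Prop :=
  [/\ hom k j, hom k f, injective j, surj f &
      forall p, f p = 0 <-> exists z, j z = p].

Section HomTheory.
Variables (k : nat) (M N : rep).

Lemma hom0 (f : M -> N) : hom k f -> f 0 = 0.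
Proof. by case=> /linear_morphism[]. Qed.
Lemma homD (f : M -> N) : hom k f -> forall u v, f (u + v) = f u + f v.
Proof. by case=> /linear_morphism[]. Qed.
Lemma homB (f : M -> N) : hom k f -> forall u v, f (u - v) = f u - f v.
Proof. by case=> /linear_morphism[]. Qed.
Lemma homZ (f : M -> N) : hom k f -> forall a u, f (a *: u) = a *: f u.
Proof. by case=> /linear_morphism[]. Qed.
Lemma homX (f : M -> N) i : hom k f -> (i < k)%N ->
  forall v, f (opx i v) = opx i (f v).
Proof. by move=> [_ h] /h[]. Qed.
Lemma homY (f : M -> N) i : hom k f -> (i < k)%N ->
  forall v, f (opy i v) = opy i (f v).
Proof. by move=> [_ h] /h[]. Qed.

End HomTheory.

Section HomClosure.
Variables (k : nat) (M N L : rep).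

Lemma hom_id : hom k (id : M -> M).
Proof. by split=> // i ik; split. Qed.

Lemma hom_comp (f : M -> N) (g : N -> L) : hom k f -> hom k g -> hom k (g \o f).
Proof.
move=> hf hg; split=> [a u v|i ik].
  by rewrite /= hf.1 hg.1.
by split=> v /=; rewrite ?(homX hf) ?(homY hf) ?(homX hg) ?(homY hg).
Qed.

Lemma homW m (f : M -> N) : (m <= k)%N -> hom k f -> hom m f.
Proof. by move=> mk [lf hf]; split=> // i im; apply: hf; apply: leq_trans mk. Qed.

Lemma is_repW m : (m <= k)%N -> is_rep k M -> is_rep m M.
Proof. by move=> mk rM i im; apply: rM; apply: leq_trans mk. Qed.

Lemma hom_zero : is_rep k N -> hom k (fun _ : M => 0 : N).
Proof.
move=> rN; split=> [a u v|i ik]; first by rewrite scaler0 addr0.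
by have [hx hy _] := rN i ik; rewrite (hom0 hx) (hom0 hy).
Qed.

Lemma hom_add (f g : M -> N) : is_rep k N -> hom k f -> hom k g ->
  hom k (fun v => f v + g v).
Proof.
move=> rN hf hg; split=> [a u v|i ik].
  by rewrite hf.1 hg.1 scalerDr addrACA.
have [hx hy _] := rN i ik.
by split=> v; rewrite ?(homX hf) ?(homY hf) ?(homX hg) ?(homY hg) // ?(homD hx)
  ?(homD hy).
Qed.

Lemma hom_sub (f g : M -> N) : is_rep k N -> hom k f -> hom k g ->
  hom k (fun v => f v - g v).
Proof.
move=> rN hf hg; split=> [a u v|i ik].
  by rewrite hf.1 hg.1 scalerBr opprD addrACA.
have [hx hy _] := rN i ik.
by split=> v; rewrite ?(homX hf) ?(homY hf) ?(homX hg) ?(homY hg) // ?(homB hx)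
  ?(homB hy).
Qed.

End HomClosure.

Lemma hom_inj_factor k (Z P M : rep) (j : Z -> P) (g : M -> P) :
  hom k j -> injective j -> hom k g -> (forall m, exists z, j z = g m) ->
  exists g' : M -> Z, hom k g' /\ forall m, j (g' m) = g m.
Proof.
move=> hj ij hg /choice[g' g'E]; exists g'; split=> //; split=> [a u v|i ik].
  by apply: ij; rewrite hj.1 !g'E hg.1.
by split=> v; apply: ij; rewrite ?(homX hj) ?(homY hj) // !g'E ?(homX hg) ?(homY hg).
Qed.

(** * Coinduction and restriction of projectives *)

Section Coinduction.
Variables (k : nat) (N : rep).

(* S_(k+1) is S_k tensor S_1 and S_1 has basis [x^i y^j]; an element [phi] of the
   coinduced module records the values [phi i j] on this basis, and the
   operators of index [k] act by right translation. *)
Definition coind_x (m : nat) (phi : nat -> nat -> N) : nat -> nat -> N :=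
  fun i j => if m == k then (if j is j'.+1 then phi i j' else phi i.+1 0)
             else opx m (phi i j).
Definition coind_y (m : nat) (phi : nat -> nat -> N) : nat -> nat -> N :=
  fun i j => if m == k then phi i j.+1 else opy m (phi i j).
Definition coind : rep := @Rep (nat -> nat -> N) coind_x coind_y.

Lemma coind_opxk (phi : coind) :
  opx k phi = fun i j => if j is j'.+1 then phi i j' else phi i.+1 0.
Proof. by apply/funext=> i; apply/funext=> -[|j]; rewrite /= /coind_x eqxx. Qed.

Lemma coind_opyk (phi : coind) : opy k phi = fun i j => phi i j.+1.
Proof. by apply/funext=> i; apply/funext=> j; rewrite /= /coind_y eqxx. Qed.

Lemma coind_opx m (phi : coind) : (m < k)%N -> opx m phi = fun i j => opx m (phi i j).
Proof. by move=> mk; apply/funext=> i; apply/funext=> j; rewrite /= /coind_x ltn_eqF. Qed.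

Lemma coind_opy m (phi : coind) : (m < k)%N -> opy m phi = fun i j => opy m (phi i j).
Proof. by move=> mk; apply/funext=> i; apply/funext=> j; rewrite /= /coind_y ltn_eqF. Qed.

Hypothesis rN : is_rep k N.

Lemma coind_is_rep : is_rep k.+1 coind.
Proof.
move=> m; rewrite ltnS leq_eqVlt => /orP[/eqP->|mk].
  split=> [||phi]; last by rewrite coind_opyk coind_opxk.
  - split=> [a u v|i ik].
      by rewrite !coind_opxk; apply/funext=> i; apply/funext=> -[].
    by split=> phi; rewrite ?(coind_opx _ ik) ?(coind_opy _ ik) !coind_opxk;
      apply/funext=> p; apply/funext=> -[].
  - split=> [a u v|i ik]; first by rewrite !coind_opyk.
    by split=> phi; rewrite ?(coind_opx _ ik) ?(coind_opy _ ik) !coind_opyk.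
have [hx hy xK] := rN mk.
have im i : (i < m)%N -> (i < k)%N by move=> im; apply: ltn_trans mk.
split=> [||phi]; last first.
- by rewrite coind_opy // coind_opx //; apply/funext=> p; apply/funext=> q; rewrite xK.
- split=> [a u v|i /[dup] ilm /im ik].
    by rewrite !coind_opy //; apply/funext=> i; apply/funext=> j; apply: hy.1.
  by split=> phi; rewrite !(coind_opy _ mk) ?(coind_opx _ ik) ?(coind_opy _ ik);
    apply/funext=> p; apply/funext=> q; rewrite ?(homX hy) ?(homY hy).
- split=> [a u v|i /[dup] ilm /im ik].
    by rewrite !coind_opx //; apply/funext=> i; apply/funext=> j; apply: hx.1.
  by split=> phi; rewrite !(coind_opx _ mk) ?(coind_opx _ ik) ?(coind_opy _ ik);
    apply/funext=> p; apply/funext=> q; rewrite ?(homX hx) ?(homY hx).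
Qed.

Lemma hom_coind_ev : hom k (fun phi : coind => phi 0%N 0%N).
Proof. by split=> // i ik; split=> phi; rewrite ?coind_opx ?coind_opy. Qed.

Lemma iter_hom m (M : rep) (f : M -> M) i : hom m f -> hom m (iter i f).
Proof.
by move=> hf; elim: i => [//|i IH]; apply: (hom_comp IH hf).
Qed.

(** The adjoint of [h] sends [v] to the function [b |-> h (b v)] on basis elements [b = x^i y^j]. *)
Lemma hom_coind_lift (F : rep) (h : F -> N) : is_rep k.+1 F -> hom k h ->
  hom k.+1 (fun v : F => (fun i j => h (iter i (opx k) (iter j (opy k) v))) : coind).
Proof.
move=> rF hh; have [hx hy xK] := rF k (leqnn _).
have hij i j : hom k (iter i (@opx F k) \o iter j (@opy F k)).
  by apply: hom_comp; exact: iter_hom.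
have hhij i j := hom_comp (hij i j) hh.
split=> [a u v|m].
  by apply/funext=> i; apply/funext=> j; apply: (hhij i j).1.
rewrite ltnS leq_eqVlt => /orP[/eqP->|mk]; split=> v;
  rewrite ?coind_opxk ?coind_opyk ?coind_opx ?coind_opy //; apply/funext=> i; apply/funext=> j.
- by case: j => [|j] /=; rewrite -?iterSr -?iterS; [rewrite iterSr | rewrite iterSr xK].
- by rewrite -iterSr.
- exact: (homX (hhij i j)).
- exact: (homY (hhij i j)).
Qed.

End Coinduction.

Lemma hom_coind_map k (M N : rep) (g : M -> N) : hom k g ->
  hom k.+1 (fun phi : coind k M => (fun i j => g (phi i j)) : coind k N).
Proof.
move=> hg; split=> [a u v|m].
  by apply/funext=> i; apply/funext=> j; apply: hg.1.
rewrite ltnS leq_eqVlt => /orP[/eqP->|mk]; split=> v;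
  rewrite ?coind_opxk ?coind_opyk ?coind_opx ?coind_opy //; apply/funext=> i; apply/funext=> j;
  rewrite ?(homX hg) ?(homY hg) //.
by case: j.
Qed.

(** Coinduction turns a lifting problem over [S_k] into one over [S_(k+1)]; evaluating the solution
    at the basis element 1 brings it back. *)
Lemma kproj_restrict k (F : rep) : is_rep k.+1 F -> kproj k.+1 F -> kproj k F.
Proof.
move=> rF pF M N g h rM rN hg sg hh.
have [|H [hH HE]] := pF _ _ _ _ (coind_is_rep rM) (coind_is_rep rN)
  (hom_coind_map hg) _ (hom_coind_lift rF hh).
  move=> phi; have [s gs] := choice sg.
  by exists (fun i j => s (phi i j)); apply/funext=> i; apply/funext=> j; exact: gs.
exists (fun v => H v 0%N 0%N); split.
  exact: (hom_comp (homW (leqnSn k) hH) (hom_coind_ev k M)).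
by move=> v; rewrite -[LHS]/((fun i j => g (H v i j)) 0%N 0%N) HE.
Qed.

Lemma kproj_restrict_le k m (F : rep) : (m <= k)%N ->
  is_rep k F -> kproj k F -> kproj m F.
Proof.
elim: k => [|k IH]; first by rewrite leqn0 => /eqP->.
rewrite leq_eqVlt => /orP[/eqP->//|mk] rF pF.
by apply: IH => //; [exact: (is_repW (leqnSn k)) | exact: kproj_restrict].
Qed.

Lemma kproj0 (P : rep) : kproj 0 P.
Proof.
move=> M N g h _ _ [lg _] sg [lh _].
have [g0 gD gB gZ] := linear_morphism lg.
(* A maximal subspace meeting [ker g] trivially is a complement of [ker g].
   [split_sub] admits the empty set because of the empty chain. *)
pose split_sub (W : set M) :=
  (forall a u v, W u -> W v -> W (a *: u + v)) /\ (forall u, W u -> g u = 0 -> u = 0).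
have [W [[WL Wg] Wmax]] : exists W, split_sub W /\
    forall B, (W `<` B)%classic -> ~ split_sub B.
  apply: Zorn_bigcup => F FP totF; split=> [a u v [X FX Xu] [Y FY Yv]|u [X FX Xu]].
    have [XY|YX] := totF _ _ FX FY.
      by exists Y => //; apply: (FP _ FY).1 => //; exact: XY.
    by exists X => //; apply: (FP _ FX).1 => //; exact: YX.
  exact: (FP _ FX).2.
have Wadd (B : set M) : (W `<=` B)%classic -> split_sub B -> (B `<=` W)%classic.
  by move=> WB sB; apply: contrapT => nBW; exact: Wmax sB.
(* The empty set satisfies [split_sub], so [0] is in [W] only by maximality. *)
have W0 : W 0.
  apply: (Wadd (fun u => u = 0 \/ W u)) => [u|| ]; [by right| |by left].
  split=> [a u v|u] [->|Wu]; [|move=> [->|Wv]; right|by []|exact: Wg].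
  - by move=> [->|Wv]; rewrite scaler0 add0r; [left|right].
  - by apply: (WL) => //; rewrite -(subrr u) addrC -scaleN1r; exact: WL.
  - exact: WL.
have Wg_surj v : exists w, W w /\ g w = v.
  have [u <-] := sg v; have [[w [Ww gw]]|nw] := pselect (exists w, W w /\ g w = g u).
    by exists w.
  exists u; split=> //.
  (* When [g u] is not attained on [W], the span of [u] and [W] still meets [ker g] trivially, so
     maximality puts [u] in [W]. *)
  pose B x := exists c w, W w /\ x = c *: u + w.
  apply: (Wadd B); last by exists 1, 0; rewrite scale1r addr0.
    by move=> w Ww; exists 0, w; rewrite scale0r add0r.
  split=> [a _ _ [c1 [w1 [W1 ->]]] [c2 [w2 [W2 ->]]]|_ [c [w [Ww ->]]]].
    exists (a * c1 + c2), (a *: w1 + w2); split; first exact: WL.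
    by rewrite scalerDr scalerA scalerDl addrACA.
  rewrite gD gZ; have [->|c0] := eqVneq c 0; first by rewrite !scale0r !add0r; exact: Wg.
  move=> e; case: nw; exists ((- c^-1) *: w + 0); split; first exact: (WL).
  by rewrite addr0 gZ -(addrK (c *: g u) (g w)) (addrC (g w)) e sub0r scalerN scaleNr
    opprK scalerA mulVf // scale1r.
have [s sE] := choice Wg_surj.
(* The defect of linearity of [s] lies in [W] and is killed by [g]. *)
have sL : linear s.
  move=> a u v; apply/eqP; rewrite -subr_eq0; apply/eqP/Wg.
    rewrite -scaleN1r [X in W X]addrC; apply: (WL); last exact: (sE _).1.
    by apply: WL; exact: (sE _).1.
  by rewrite gB gD gZ !(sE _).2 subrr.
exists (s \o h); split; last by move=> v; rewrite /= (sE _).2.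
by split=> // a u v /=; rewrite lh sL.
Qed.

(** * Extensions by cocycles and the upper bound *)

Section Twist.
Variables (k : nat) (M N : rep) (al be : M -> N).

Definition twist_x m (p : M * N) : M * N :=
  (opx m p.1, opx m p.2 + (if m == k then al p.1 else 0)).
Definition twist_y m (p : M * N) : M * N :=
  (opy m p.1, opy m p.2 + (if m == k then be p.1 else 0)).
Definition twist : rep := @Rep (M * N)%type twist_x twist_y.

Hypotheses (rM : is_rep k.+1 M) (rN : is_rep k.+1 N).
Hypotheses (hal : hom k al) (hbe : hom k be).
Hypothesis cocycle : forall v, opy k (al v) + be (opx k v) = 0.

Lemma twist_op_hom m (opM : M -> M) (opN : N -> N) (d : M -> N) : (m <= k)%N ->
  hom m opM -> hom m opN -> hom m d ->
  hom m (fun p : twist => (opM p.1, opN p.2 + d p.1) : twist).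
Proof.
move=> mk hM hN hd; split=> [a u v|i im].
  congr pair; first exact: hM.1.
  by rewrite /= hN.1 hd.1 scalerDr addrACA.
have ik : (i < k)%N := leq_trans im mk.
have [hx hy _] := rN (ltnW ik : (i < k.+1)%N).
split=> -[u v]; rewrite /= /twist_x /twist_y (ltn_eqF ik) /= !addr0.
  by rewrite (homX hM) // (homX hN) // (homX hd) // (homD hx).
by rewrite (homY hM) // (homY hN) // (homY hd) // (homD hy).
Qed.

(** The relation [y x = 1] at index [k] reduces to [cocycle]; commutation with smaller indices holds
    because [al] and [be] are [S_k]-maps. *)
Lemma twist_is_rep : is_rep k.+1 twist.
Proof.
move=> m mk1; have mk : (m <= k)%N by [].
have [hMx hMy MK] := rM mk1; have [hNx hNy NK] := rN mk1.
have rNm : is_rep m N := is_repW (ltnW mk1) rN.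
have hd (d : M -> N) : hom k d -> hom m (fun v => if m == k then d v else 0).
  by move=> hd; case: eqP => _; [exact: homW hd | exact: hom_zero].
split; [exact: (twist_op_hom mk hMx hNx (hd _ hal))
       |exact: (twist_op_hom mk hMy hNy (hd _ hbe))|].
move=> [u v]; rewrite /= /twist_x /twist_y /= MK (homD hNy) NK; congr pair.
case: eqP => [mk'|_]; last by rewrite (hom0 hNy) !addr0.
by rewrite mk' -addrA cocycle addr0.
Qed.

End Twist.

(* For [M] projective over [S_k], an extension of [M] by [N] over [S_(k+1)] is
   [M * N] with the operators of index [k] twisted by a cocycle [(al, be)],
   [y al + be x = 0]. Cocycles lift along an epimorphism [N' -> N]: lift [al]
   and [be] arbitrarily and replace [al] by [al - x (y al + be x)]. Hence
   Ext^2 vanishes. *)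
Lemma kproj_syzygy k (Z F M : rep) (j : Z -> F) (f : F -> M) :
  is_rep k.+1 F -> is_rep k.+1 M ->
  ses k.+1 j f -> kproj k M -> kproj k.+1 F -> kproj k.+1 Z.
Proof.
move=> rF rM [hj hf ij sf ex] pM pF N' N g h rN' rN hg sg hh.
have k1 := leqnSn k.
(* [sig] splits [f] over [S_k]; its failure to commute with [x_k] and [y_k] is the cocycle
   [(dx, dy)] of [F] as an extension of [M] by [Z]. *)
have [sig [hsig fsig]] := pM _ _ _ _ (is_repW k1 rF) (is_repW k1 rM) (homW k1 hf) sf (hom_id k M).
have [hFx hFy FK] := rF k (leqnn _); have [hMx hMy MK] := rM k (leqnn _).
have [hN'x hN'y N'K] := rN' k (leqnn _); have [hNx _ _] := rN k (leqnn _).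
have rFk := is_repW k1 rF.
have rN'k := is_repW k1 rN'.
have [dx [hdx jdx]] : exists dx : M -> Z, hom k dx /\
    forall m, j (dx m) = opx k (sig m) - sig (opx k m).
  apply: (hom_inj_factor (homW k1 hj) ij) => [|m].
    by apply: hom_sub => //; apply: hom_comp.
  by apply/ex; rewrite (homB hf) (homX hf) // !fsig subrr.
have [dy [hdy jdy]] : exists dy : M -> Z, hom k dy /\
    forall m, j (dy m) = opy k (sig m) - sig (opy k m).
  apply: (hom_inj_factor (homW k1 hj) ij) => [|m].
    by apply: hom_sub => //; apply: hom_comp.
  by apply/ex; rewrite (homB hf) (homY hf) // !fsig subrr.
have [r [hr jr]] : exists r : F -> Z, hom k r /\ forall u, j (r u) = u - sig (f u).
  apply: (hom_inj_factor (homW k1 hj) ij) => [|u].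
    by apply: hom_sub => //; apply: hom_comp hsig; exact: homW hf.
  by apply/ex; rewrite (homB hf) fsig subrr.
have hhk := homW k1 hh.
have [al [hal gal]] := pM _ _ _ _ rN'k (is_repW k1 rN) (homW k1 hg) sg (hom_comp hdx hhk).
have [be [hbe gbe]] := pM _ _ _ _ rN'k (is_repW k1 rN) (homW k1 hg) sg (hom_comp hdy hhk).
have cocZ v : opy k (dx v) + dy (opx k v) = 0.
  apply: ij; rewrite (homD hj) (homY hj) // jdx jdy (homB hFy) FK MK (hom0 hj).
  by rewrite addrA subrK subrr.
have cocN v : opy k (h (dx v)) + h (dy (opx k v)) = 0.
  by rewrite -(homY hh) // -(homD hh) cocZ (hom0 hh).
pose al' v := al v - opx k (opy k (al v) + be (opx k v)).
have hal' : hom k al'.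
  apply: hom_sub => //; apply: (hom_comp (g := opx k)) => //.
  by apply: hom_add => //; apply: hom_comp.
have coc' v : opy k (al' v) + be (opx k v) = 0.
  by rewrite /al' (homB hN'y) N'K opprD addrA subrr sub0r addNr.
have gal' v : g (al' v) = h (dx v).
  by rewrite (homB hg) (homX hg) // (homD hg) (homY hg) // gal gbe /= cocN (hom0 hNx) subr0.
(* [E] is the pushout of the extension [F] along [h], with canonical map [phi]; [G] maps an
   extension of [M] by [N'] onto it. *)
pose E' := twist k al' be; pose E := twist k (h \o dx) (h \o dy).
have rE' : is_rep k.+1 E' by exact: twist_is_rep.
have rE : is_rep k.+1 E by apply: twist_is_rep => //; apply: hom_comp.
pose G (p : E') : E := (p.1, g p.2).
have hG : hom k.+1 G.
  split=> [a [u1 u2] [v1 v2]|i ik]; first by congr pair; exact: hg.1.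
  split=> -[u v]; rewrite /G /= /twist_x /twist_y /=; congr pair;
    rewrite (homD hg) ?(homX hg) ?(homY hg) //; congr (_ + _); case: eqP => _;
    by rewrite ?(hom0 hg) ?gal' ?gbe.
have sG : surj G.
  by move=> [u v]; have [v' <-] := sg v; exists (u, v').
pose phi (u : F) : E := (f u, h (r u)).
have hphi : hom k.+1 phi.
  split=> [a u v|i]; first by congr pair; [exact: hf.1 | exact: (hom_comp hr hhk).1].
  rewrite ltnS leq_eqVlt => /orP[/eqP->|ik].
    split=> u; rewrite /phi /= /twist_x /twist_y /= eqxx ?(homX hf) ?(homY hf) //; congr pair.
      rewrite -(homX hh) // -(homD hh); congr h; apply: ij.
      by rewrite (homD hj) (homX hj) // !jr jdx (homB hFx) (homX hf) // addrA subrK.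
    rewrite -(homY hh) // -(homD hh); congr h; apply: ij.
    by rewrite (homD hj) (homY hj) // !jr jdy (homB hFy) (homY hf) // addrA subrK.
  split=> u; rewrite /phi /= /twist_x /twist_y /= (ltn_eqF ik) addr0; congr pair;
    by rewrite ?(homX hf) ?(homY hf) ?(homX hr) ?(homY hr) ?(homX hhk) ?(homY hhk) // ltnW.
(* On [Z] the first component of the lift of [phi] is [f], which vanishes there; the second
   component then lifts [h] to [N']. *)
have [Phi [hPhi GPhi]] := pF _ _ _ _ rE' rE hG sG hphi.
have Phi1 z : (Phi (j z)).1 = 0.
  have := GPhi (j z); rewrite /G /phi => -[-> _].
  by apply/ex; exists z.
exists (fun z => (Phi (j z)).2); split.
  split=> [a u v|i ik]; first by rewrite hj.1 hPhi.1.
  by split=> z; rewrite ?(homX hj) ?(homY hj) ?(homX hPhi) ?(homY hPhi) //= Phi1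
    ?(hom0 hal') ?(hom0 hbe) if_same addr0.
move=> z; have := GPhi (j z); rewrite /G /phi => -[_ ->]; congr h; apply: ij.
rewrite jr; have -> : f (j z) = 0 by apply/ex; exists z.
by rewrite (hom0 hsig) subr0.
Qed.

(** * The operator [y - 1] and the lower bound *)

Section Difference.
Variables (k : nat) (N : rep).
Hypothesis rN : is_rep k N.

(* Left translation by [y - 1] in the basis [x^i y^j]. *)
Definition coind_diff (phi : coind k N) : coind k N := fun i j =>
  if i is i'.+1 then phi i' j - phi i j else phi 0 j.+1 - phi 0 j.

Lemma hom_coind_diff : hom k.+1 coind_diff.
Proof.
split=> [a u v|m].
  have lin_sub (p q r s : N) : (a *: p + q) - (a *: r + s) = a *: (p - r) + (q - s).
    by rewrite scalerBr opprD addrACA.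
  by apply/funext=> -[|i]; apply/funext=> j; exact: lin_sub.
rewrite ltnS leq_eqVlt => /orP[/eqP->|mk]; split=> phi;
  rewrite ?coind_opxk ?coind_opyk ?(coind_opx _ mk) ?(coind_opy _ mk);
  apply/funext=> -[|i]; apply/funext=> // -[|j] //=; rewrite /coind_diff
   ?coind_opxk ?coind_opyk ?(coind_opx _ mk) ?(coind_opy _ mk) //=;
  by have [hx hy _] := rN mk; rewrite ?(homB hx) ?(homB hy).
Qed.

Lemma surj_coind_diff : surj coind_diff.
Proof.
move=> psi.
(* The preimage is found recursively: [col] sums up row 0, then row [i + 1] is row [i] minus
   [psi (i + 1)]. *)
pose col j := \sum_(0 <= l < j) psi 0%N l.
exists (fun i j => col j - \sum_(1 <= l < i.+1) psi l j).
apply/funext=> -[|i]; apply/funext=> j; rewrite /coind_diff /=.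
  by rewrite !big_geq // !subr0 /col big_nat_recr //= addrAC subrr add0r.
have sub_cancel (c s p : N) : c - s - (c - (s + p)) = p.
  by rewrite (opprD s) addrA opprB subrKC.
by rewrite (big_nat_recr i.+1) //= sub_cancel.
Qed.

End Difference.

(** The adjoint of [w] is lifted through the epimorphism [coind_diff], whose value at the basis
    element 1 is the difference of the values at [y] and at 1. *)
Lemma kproj_diff_factor k (Z Q : rep) (w : Z -> Q) :
  is_rep k.+1 Z -> kproj k.+1 Z -> is_rep k Q -> hom k w ->
  exists w' : Z -> Q, hom k w' /\ forall z, w z = w' (opy k z - z).
Proof.
move=> rZ pZ rQ hw.
have [W [hW DW]] := pZ _ _ _ _ (coind_is_rep rQ) (coind_is_rep rQ)
  (hom_coind_diff rQ) (surj_coind_diff (N := Q)) (hom_coind_lift rZ hw).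
exists (fun z => W z 0%N 0%N); split.
  exact: (hom_comp (homW (leqnSn k) hW) (hom_coind_ev k Q)).
move=> z; rewrite (homB hW) (homY hW) // coind_opyk.
by have /(congr1 (fun phi => phi 0%N 0%N)) := DW z.
Qed.

Fixpoint pd_le (k d : nat) (M : rep) : Prop :=
  if d is d'.+1 then
    exists (P Z : rep) (j : Z -> P) (f : P -> M),
      [/\ is_rep k P, is_rep k Z, ses k j f, kproj k P & pd_le k d' Z]
  else kproj k M.

(** Null-homotopy of [y_k - 1] without resolutions: it factors through every [S_k]-epimorphism onto
    [M], in particular from a projective. *)
Definition diff_factors k (M : rep) := forall (N : rep) (g : N -> M),
  is_rep k N -> hom k g -> surj g ->
  exists s : M -> N, hom k s /\ forall v, g (s v) = opy k v - v.

(** Subtracting [s \o f] from [y_k - 1] on [P] makes it land in the kernel of [f]; the correction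
    vanishes on [Z]. *)
Lemma ses_diff_factor k (Z P M : rep) (j : Z -> P) (f : P -> M) :
  is_rep k.+1 P -> ses k.+1 j f -> diff_factors k M ->
  exists U : P -> Z, hom k U /\ forall z, U (j z) = opy k z - z.
Proof.
move=> rP [hj hf ij sf ex] dM; have k1 := leqnSn k.
have [s [hs fs]] := dM _ _ (is_repW k1 rP) (homW k1 hf) sf.
have [_ hPy _] := rP k (leqnn _).
have [U [hU jU]] : exists U : P -> Z, hom k U /\ forall u, j (U u) = (opy k u - u) - s (f u).
  apply: (hom_inj_factor (homW k1 hj) ij) => [|u].
    apply: hom_sub; [exact: is_repW rP| |exact: hom_comp (homW k1 hf) hs].
    by apply: hom_sub => //; exact: is_repW rP.
  by apply/ex; rewrite !(homB hf) (homY hf) // fs subrr.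
exists U; split=> // z; apply: ij; rewrite jU (homB hj) (homY hj) //.
have -> : f (j z) = 0 by apply/ex; exists z.
by rewrite (hom0 hs) subr0.
Qed.

Lemma kproj_retract k (P M : rep) (f : P -> M) (s : M -> P) :
  hom k f -> hom k s -> cancel s f -> kproj k P -> kproj k M.
Proof.
move=> hf hs sK pP N' N g h rN' rN hg sg hh.
have [u [hu gu]] := pP _ _ _ _ rN' rN hg sg (hom_comp hf hh).
by exists (u \o s); split; [exact: hom_comp | move=> v; rewrite /= gu /= sK].
Qed.

(* [y_k - 1] commutes with the operators of smaller index; if it is null-homotopic
   on [M], then forgetting the operators of index [k] lowers the projective
   dimension. *)
Lemma pd_le_restrict k d (M : rep) : is_rep k.+1 M -> diff_factors k M ->
  pd_le k.+1 d.+1 M -> pd_le k d M.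
Proof.
have k1 := leqnSn k.
elim: d M => [|d IH] M rM dM [P [Z [j [f [rP rZ sjf pP]]]]] pZ;
  have [U [hU Uj]] := ses_diff_factor rP sjf dM; have [hj hf ij sf ex] := sjf;
  have pPk := kproj_restrict rP pP.
  (* [w] is a left inverse of [y_k - 1] on [Z], so [w \o U] retracts [P] onto [Z]; the complementary
     projection [t] induces an [S_k]-section of [f]. *)
  have [w [hw wE]] := kproj_diff_factor rZ pZ (is_repW k1 rZ) (hom_id k Z).
  have [s0 fs0] := choice sf.
  pose t v := v - j (w (U v)).
  have ht : hom k t.
    apply: hom_sub; [exact: is_repW rP|exact: hom_id|].
    by apply: hom_comp (homW k1 hj); exact: hom_comp hw.
  have tE v v' : f v = f v' -> t v = t v'.
    move=> e; apply/eqP; rewrite -subr_eq0 -(homB ht); apply/eqP.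
    have /ex[z <-] : f (v - v') = 0 by rewrite (homB hf) e subrr.
    by rewrite /t Uj -wE subrr.
  apply: (kproj_retract (f := f) (s := t \o s0) (homW k1 hf)) pPk.
    split=> [a u v|i ik].
      by rewrite /= -ht.1; apply: tE; rewrite hf.1 !fs0.
    by split=> v /=; rewrite -?(homX ht) -?(homY ht) //; apply: tE;
      rewrite ?(homX hf) ?(homY hf) ?fs0 // ltnW.
  move=> v; rewrite /= /t (homB hf) fs0.
  have -> : f (j (w (U (s0 v)))) = 0 by apply/ex; eexists.
  exact: subr0.
exists P, Z, j, f; split=> //; try exact: is_repW.
  by split=> //; exact: homW k1 _.
(* The hypothesis passes to [Z]: lift [U] along [g] by projectivity of [P], then compose with
   [j]. *)
apply: IH => // N g rN hg sg.
have [s [hs gs]] := pPk _ _ _ _ rN (is_repW k1 rZ) hg sg hU.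
exists (s \o j); split; first by apply: hom_comp hs; exact: homW hj.
by move=> z; rewrite /= gs Uj.
Qed.

(** Here [y_i - 1 = 0] factors through everything, so each restriction lowers [d] by one. If [d]
    reached 0 first, [v] would be the image of [y v - v = 0] under a homomorphism. *)
Lemma pd_le_ge k d (M : rep) (v : M) : is_rep k M ->
  (forall i u, (i < k)%N -> opy i u = u :> M) -> v <> 0 -> pd_le k d M -> (k <= d)%N.
Proof.
move=> + + v0; elim: k d => [//|k IH] [|d] rM yM.
  move=> pM; have [w [hw /(_ v)]] := kproj_diff_factor rM pM (is_repW (leqnSn k) rM) (hom_id k M).
  by rewrite yM // subrr (hom0 hw).
move=> pM; rewrite ltnS; apply: IH; first exact: is_repW rM.
  by move=> i u ik; apply: yM; exact: ltnW.
apply: pd_le_restrict => // N g rN hg _.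
exists (fun _ => 0 : N); split; first exact: hom_zero.
by move=> u; rewrite yM // subrr (hom0 hg).
Qed.

End Reps.

(** * Modules and projective resolutions *)

Lemma linear_bundle (R : pzRingType) (U V : lmodType R) (f : U -> V) :
  linear f -> exists F : {linear U -> V}, F = f :> (U -> V).
Proof.
move=> lf.
pose m := GRing.isLinear.Build R U V *:%R f lf.
by exists (HB.pack_for {linear U -> V} f m).
Qed.

Section Kernel.
Variables (R : pzRingType) (U V : lmodType R) (f : {linear U -> V}).

Definition ker_pred : {pred U} := fun u => f u == 0.

Lemma ker_pred_submod : submod_closed ker_pred.
Proof.
split=> [|a u v /eqP fu /eqP fv]; apply/eqP; first exact: linear0.
by rewrite linearP fu fv scaler0 addr0.
Qed.

HB.instance Definition _ := GRing.isSubmodClosed.Build R U ker_pred ker_pred_submod.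

Record ker_mod := KerMod { ker_val : U; ker_valP : ker_val \in ker_pred }.

HB.instance Definition _ := [isSub for ker_val].
HB.instance Definition _ := [Choice of ker_mod by <:].
HB.instance Definition _ := [SubChoice_isSubLmodule of ker_mod by <:].

Lemma ker_valK (z : ker_mod) : f (ker_val z) = 0.
Proof. by apply/eqP; exact: ker_valP z. Qed.

Lemma ker_val_inj : injective ker_val.
Proof. exact: val_inj. Qed.

Lemma ker_val_linear : linear ker_val.
Proof. by move=> a u v; rewrite -[ker_val _]/(\val _) linearP. Qed.

Lemma ker_val0 : ker_val 0 = 0.
Proof. by have [] := linear_morphism ker_val_linear. Qed.

Lemma ker_val_eq0 z : ker_val z = 0 -> z = 0.
Proof. by move=> z0; apply: ker_val_inj; rewrite z0 ker_val0. Qed.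

Lemma ker_exact u : f u = 0 <-> exists z, ker_val z = u.
Proof.
by split=> [/eqP fu|[z <-]]; [exists (KerMod fu) | exact: ker_valK].
Qed.

End Kernel.

(** * Free modules and enough projectives *)

Section FreeModule.
Import monalg.
Variables (R : nzRingType) (T : choiceType).

Definition freemod : lmodType R := {malg R[T]}.

Definition free_ext (V : lmodType R) (u : T -> V) (c : freemod) : V :=
  \sum_(t <- msupp c) mcoeff t c *: u t.

Lemma free_extE (V : lmodType R) (u : T -> V) (c : freemod) (s : {fset T}) :
  (msupp c `<=` s)%fset -> free_ext u c = \sum_(t <- s) mcoeff t c *: u t.
Proof.
move=> cs; rewrite /free_ext; apply: big_fset_incl => // t _ tc.
by rewrite mcoeff_outdom // scale0r.
Qed.

Lemma free_ext_linear (V : lmodType R) (u : T -> V) : linear (free_ext u).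
Proof.
move=> a c d; pose s := (msupp c `|` msupp d)%fset.
rewrite (free_extE u (s := s)); last first.
  apply: fsubset_trans (msuppD_le _ _) _; apply: fsetSU; exact: msuppZ_le.
rewrite (free_extE u (fsubsetUl _ _ : msupp c `<=` s)%fset).
rewrite (free_extE u (fsubsetUr _ _ : msupp d `<=` s)%fset).
rewrite scaler_sumr -big_split /=; apply: eq_bigr => t _.
by rewrite mcoeffD mcoeffZ scalerDl scalerA.
Qed.

Definition free_gen (t : T) : freemod := mkmalgU t 1.

Lemma free_ext_gen (V : lmodType R) (u : T -> V) t : free_ext u (free_gen t) = u t.
Proof.
rewrite (free_extE u (s := [fset t]%fset)) ?msuppU_le //.
by rewrite big_seq_fset1 mcoeffUU scale1r.
Qed.

Lemma free_gen_eq (V : lmodType R) (f g : {linear freemod -> V}) :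
  (forall t, f (free_gen t) = g (free_gen t)) -> f =1 g.
Proof.
move=> fg c; rewrite (monalgE c) !raddf_sum; apply: eq_bigr => t _ /=.
have -> : mkmalgU t (mcoeff t c) = mcoeff t c *: free_gen t.
  by apply/malgP => t'; rewrite mcoeffZ !mcoeffU mulrnAr mulr1.
by rewrite !linearZ fg.
Qed.

Lemma projective_freemod : projective_mod freemod.
Proof.
move=> M N g h sg; have [s gs] := choice sg.
have [h' h'E] := linear_bundle (free_ext_linear (fun t => s (h (free_gen t)))).
exists h'; apply: (free_gen_eq (f := g \o h' : {linear _ -> _})) => t.
by rewrite /= h'E free_ext_gen gs.
Qed.

End FreeModule.

Lemma enough_projectives (R : nzRingType) (M : lmodType R) :
  exists (F : lmodType R) (p : {linear F -> M}), projective_mod F /\ surj p.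
Proof.
have [p pE] := linear_bundle (free_ext_linear (fun v : M => v)).
exists (freemod R M), p; split; first exact: projective_freemod.
by move=> v; exists (free_gen R v); rewrite pE free_ext_gen.
Qed.

(** * Splicing and truncating resolutions *)

Section Resolutions.
Variable R : pzRingType.

Lemma pdim_le0 (P : lmodType R) : projective_mod P -> pdim_le P 0.
Proof.
move=> pP; pose O : lmodType R := 'rV[R]_0.
have O0 (u v : O) : u = v by apply/rowP => -[].
pose Q k : lmodType R := if k is 0%N then P else O.
exists Q, (fun k => \0 : {linear Q k.+1 -> Q k}), (idfun : {linear Q 0%N -> P}).
split=> [[|k]|[|k] //=|m|p|k p].
- exact: pP.
- move=> M N g h sg; exists (\0 : {linear O -> M}) => p.
  by rewrite (O0 p 0) !linear0.
- by exists m.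
- by split=> [p0|[q <-] //]; exists 0; exact: esym p0.
- by split=> // _; exists 0; exact: O0.
Qed.

(** Splicing: the new first differential is the augmentation onto the kernel followed by the
    inclusion. *)
Lemma pdim_leS (P M : lmodType R) (f : {linear P -> M}) d :
  projective_mod P -> surj f -> pdim_le (ker_mod f) d -> pdim_le M d.+1.
Proof.
move=> pP sf [Q [dd [eps [pQ Q0 epsS ex0 exS]]]].
have [d0 d0E] : exists F : {linear Q 0%N -> P}, F = (fun q => ker_val (eps q)) :> (_ -> _).
  by apply: linear_bundle => a u v; rewrite linearP ker_val_linear.
pose P' k : lmodType R := if k is k'.+1 then Q k' else P.
pose dd' k : {linear P' k.+1 -> P' k} :=
  match k return {linear P' k.+1 -> P' k} with
  | 0%N => d0 | k'.+1 => dd k' end.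
exists P', dd', f; split.
- by case.
- by case=> // k dk; exact: Q0.
- exact: sf.
- move=> p /=; rewrite d0E; split=> [/ker_exact[z <-]|[q <-]]; last exact: ker_valK.
  by have [q <-] := epsS z; exists q.
- case=> [|k] p; last exact: exS.
  have d0_ker : d0 p = 0 <-> exists q, dd 0%N q = p.
    by rewrite d0E -ex0; split=> [/ker_val_eq0|->]; last exact: ker_val0.
  exact: d0_ker.
Qed.

(** Truncation: the first differential, corestricted to the kernel, becomes the augmentation. *)
Lemma pdim_leS_inv (M : lmodType R) d : pdim_le M d.+1 ->
  exists (P : lmodType R) (f : {linear P -> M}),
    [/\ projective_mod P, surj f & pdim_le (ker_mod f) d].
Proof.
move=> [P [dd [eps [pP P0 epsS ex0 exS]]]].
exists (P 0%N), eps; split=> //.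
have ddK q : dd 0%N q \in ker_pred eps by apply/eqP/ex0; exists q.
have [e eE] : exists F : {linear P 1%N -> ker_mod eps}, F = (fun q => KerMod (ddK q)) :> (_ -> _).
  by apply: linear_bundle => a u v; apply: ker_val_inj; rewrite ker_val_linear /= linearP.
exists (fun k => P k.+1), (fun k => dd k.+1), e; split=> //.
- by move=> k dk; exact: P0.
- move=> z; have /ex0[q qE] := ker_valK z.
  by exists q; apply: ker_val_inj; rewrite eE.
- move=> p; rewrite -exS eE; split=> [/(congr1 (@ker_val _ _ _ _)) /= ->|p0].
    by [].
  exact: ker_val_eq0.
Qed.

End Resolutions.

(** * The algebra S_n *)

Section SubalgebraInduction.
Variables (K : fieldType) (n : nat) (A : algType K) (x y : 'I_n -> A).
Hypothesis hS : is_Sn x y.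
Variables (S : {pred A}) (S_closed : subalg_closed S).

HB.instance Definition _ := GRing.isSubalgClosed.Build K A S S_closed.
Record gen_sub := GenSub { gen_val : A; gen_valP : gen_val \in S }.
HB.instance Definition _ := [isSub for gen_val].
HB.instance Definition _ := [Choice of gen_sub by <:].
HB.instance Definition _ := [SubChoice_isSubAlgebra of gen_sub by <:].

(** The universal map from [A] to the subalgebra, followed by the inclusion, is the identity by
    uniqueness. *)
Lemma Sn_ind : (forall i, x i \in S) -> (forall i, y i \in S) -> forall a, a \in S.
Proof.
move=> xS yS a; have [[rel comm] univ] := hS.
have relS : Sn_relations (fun i => GenSub (xS i)) (fun i => GenSub (yS i)).
  split=> [i|i j ij]; first by apply: val_inj; exact: rel.
  by have [xy xx yy] := comm i j ij; split; apply: val_inj.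
have [[f [[fD fM f1 fZ] [fx fy]]] _] := univ gen_sub _ _ relS.
have [_ uniq] := univ A x y (conj rel comm).
rewrite (_ : a = val (f a)); first exact: valP.
apply: (uniq id (fun a => val (f a))) => // [|i|i]; rewrite ?fx ?fy //.
by split=> [u v|u v||k u]; rewrite ?fD ?fM ?f1 ?fZ.
Qed.

End SubalgebraInduction.

(** * The endomorphism algebra of a nonzero space *)

Section Endomorphisms.
Variables (K : fieldType) (V : lmodType K).

Definition lin_pred : {pred V -> V} := fun f => `[< linear f >].

Lemma lin_pred_submod : submod_closed lin_pred.
Proof.
split=> [|a f g /asboolP lf /asboolP lg]; apply/asboolP => b u v.
  by rewrite /GRing.zero /= scaler0 addr0.
rewrite -[LHS]/(a *: f (b *: u + v) + g (b *: u + v)) lf lg.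
rewrite -[RHS]/(b *: (a *: f u + g u) + (a *: f v + g v)).
by rewrite !scalerDr addrACA !scalerA mulrC.
Qed.

HB.instance Definition _ :=
  GRing.isSubmodClosed.Build K (V -> V) lin_pred lin_pred_submod.
Record lin_end := LinEnd { lin_fun :> V -> V; lin_funP : lin_fun \in lin_pred }.
HB.instance Definition _ := [isSub for lin_fun].
HB.instance Definition _ := [Choice of lin_end by <:].
HB.instance Definition _ := [SubChoice_isSubLmodule of lin_end by <:].

Lemma lin_end_linear (f : lin_end) : linear f.
Proof. exact/asboolP/(lin_funP f). Qed.

Lemma lin_endP (f g : lin_end) : (forall v, f v = g v) -> f = g.
Proof. by move=> fg; apply: val_inj; apply/funext. Qed.

Definition lin_id : lin_end := LinEnd (asboolT (fun a u v => erefl) : id \in lin_pred).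

Lemma lin_comp_subproof (f g : lin_end) : (f \o g) \in lin_pred.
Proof. by apply/asboolP => a u v; rewrite /= !lin_end_linear. Qed.
Definition lin_comp (f g : lin_end) : lin_end := LinEnd (lin_comp_subproof f g).

(* An [algType] has [1 != 0], so the zero space must be excluded. *)
Definition end_alg (v0 : V) (nz : v0 != 0) : Type := lin_end.
Section NonZero.
Variables (v0 : V) (nz : v0 != 0).
HB.instance Definition _ := GRing.Lmodule.on (end_alg nz).

Lemma lin_compDl : left_distributive lin_comp +%R.
Proof. by move=> f g h; apply: lin_endP. Qed.
Lemma lin_compDr : right_distributive lin_comp +%R.
Proof.
by move=> f g h; apply: lin_endP => v; have [_ fD _ _] := linear_morphism (lin_end_linear f);
  exact: fD.
Qed.
Lemma lin_id_neq0 : lin_id != 0 :> lin_end.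
Proof. by apply: contra_neq nz => /(congr1 (fun f : lin_end => f v0)). Qed.

Lemma lin_compA : associative lin_comp.
Proof. by move=> f g h; apply: lin_endP. Qed.
Lemma lin_comp1f : left_id lin_id lin_comp.
Proof. by move=> f; apply: lin_endP. Qed.
Lemma lin_compf1 : right_id lin_id lin_comp.
Proof. by move=> f; apply: lin_endP. Qed.
HB.instance Definition _ := GRing.Zmodule_isNzRing.Build (end_alg nz)
  lin_compA lin_comp1f lin_compf1 lin_compDl lin_compDr lin_id_neq0.
Lemma lin_comp_scalel (a : K) (f g : end_alg nz) : a *: (f * g) = (a *: f) * g.
Proof. exact: lin_endP. Qed.
HB.instance Definition _ := GRing.Lmodule_isLalgebra.Build K (end_alg nz) lin_comp_scalel.
Lemma lin_comp_scaler (a : K) (f g : end_alg nz) : a *: (f * g) = f * (a *: g).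
Proof.
by apply: lin_endP => v; have [_ _ _ fZ] := linear_morphism (lin_end_linear f);
  exact: esym (fZ _ _).
Qed.
HB.instance Definition _ := GRing.Lalgebra_isAlgebra.Build K (end_alg nz) lin_comp_scaler.
End NonZero.
End Endomorphisms.

(** * The opposite algebra *)

Section Converse.
Variables (K : fieldType) (A : algType K).

HB.instance Definition _ := GRing.Zmodule_isLmodule.Build K A^c
  (@scalerA K A) (@scale1r K A) (@scalerDr K A) (@scalerDl K A).
Lemma converse_scaleAl (a : K) (u v : A^c) : a *: (u * v) = (a *: u : A^c) * v.
Proof. exact: (@scalerAr K A). Qed.
HB.instance Definition _ := GRing.Lmodule_isLalgebra.Build K A^c converse_scaleAl.
Lemma converse_scaleAr (a : K) (u v : A^c) : a *: (u * v) = u * (a *: v : A^c).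
Proof. exact: (@scalerAl K A). Qed.
HB.instance Definition _ := GRing.Lalgebra_isAlgebra.Build K A^c converse_scaleAr.

End Converse.

(** Reversing the product in [y x = 1] exchanges [x] and [y]. Homomorphisms [A^c -> B] are
    homomorphisms [A -> B^c], which transfers the universal property. *)
Lemma is_Sn_converse (K : fieldType) (n : nat) (A : algType K) (x y : 'I_n -> A) :
  is_Sn x y -> @is_Sn K n A^c y x.
Proof.
move=> [[rel comm] univ].
have conv_hom (C D : algType K) (f : C -> D) : is_alg_hom f ->
    @is_alg_hom K C^c D^c f.
  by move=> [fD fM f1 fZ]; split=> // u v; exact: fM.
have conv_rel (C : algType K) (a b : 'I_n -> C) : Sn_relations a b ->
    @Sn_relations K n C^c b a.
  move=> [r c]; split=> [i|i j ij]; first exact: r.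
  have ji : j != i by rewrite eq_sym.
  have [_ aa bb] := c i j ij; have [ba _ _] := c j i ji.
  by split; [exact: ba | exact: esym bb | exact: esym aa].
split; first exact: conv_rel.
move=> B a b relB.
have [[f [hf [fx fy]]] uniq] := univ B^c b a (conv_rel _ _ _ relB).
split; first by exists f; split; [exact: (conv_hom A B^c) | split].
move=> g h hg hh gx gy; apply: uniq => //; first exact: (conv_hom A^c B).
exact: (conv_hom A^c B).
Qed.

(** * Equivalence of [A]-modules with spaces with operators *)

Section ModulesAsReps.
Variables (K : fieldType) (n : nat) (A : algType K) (x y : 'I_n -> A).
Hypothesis hS : is_Sn x y.

Section Restriction.
Variable V : lmodType A.
Definition scalars : Type := V.
HB.instance Definition _ := GRing.Zmodule.on scalars.
Definition scalars_scale (k : K) (v : scalars) : scalars := (k%:A : A) *: (v : V).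
Lemma scalars_scaleA a b v : scalars_scale a (scalars_scale b v) = scalars_scale (a * b) v.
Proof. by rewrite /scalars_scale scalerA -scalerAl mul1r scalerA. Qed.
Lemma scalars_scale1 : left_id 1 scalars_scale.
Proof. by move=> v; rewrite /scalars_scale !scale1r. Qed.
Lemma scalars_scaleDr : right_distributive scalars_scale +%R.
Proof. by move=> a u v; rewrite /scalars_scale scalerDr. Qed.
Lemma scalars_scaleDl v : {morph scalars_scale^~ v : a b / a + b}.
Proof. by move=> a b; rewrite /scalars_scale !scalerDl. Qed.
HB.instance Definition _ := GRing.Zmodule_isLmodule.Build K scalars
  scalars_scaleA scalars_scale1 scalars_scaleDr scalars_scaleDl.

(** Operators are indexed by natural numbers; the default from [n] on is the identity. *)
Definition gen_act (z : 'I_n -> A) (i : nat) (v : scalars) : scalars :=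
  if insub i is Some i' then z i' *: (v : V) else v.

Definition rep_of : rep K := @Rep K scalars (gen_act x) (gen_act y).

Lemma gen_actE z i (ik : (i < n)%N) v : gen_act z i v = z (Ordinal ik) *: (v : V).
Proof. by rewrite /gen_act insubT. Qed.

Lemma rep_of_scale (k : K) (v : rep_of) : k *: v = (k%:A : A) *: (v : V).
Proof. by []. Qed.

Lemma algK_comm (k : K) (a : A) : k%:A * a = a * k%:A :> A.
Proof. by rewrite -scalerAl mul1r -scalerAr mulr1. Qed.

Lemma gen_act_linear z i : (i < n)%N -> linear (gen_act z i).
Proof.
move=> ik a u v; rewrite !gen_actE [LHS]scalerDr; congr (_ + _).
by rewrite [LHS]scalerA -algK_comm -scalerA.
Qed.

Lemma rep_of_is_rep : is_rep n rep_of.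
Proof.
have [[rel comm] _] := hS => i ik.
have ne j (jn : (j < n)%N) : (j < i)%N ->
    Ordinal ik != Ordinal jn /\ Ordinal jn != Ordinal ik.
  by move=> ji; rewrite eq_sym; split; rewrite -val_eqE /= ltn_eqF.
split.
- split=> [|j ji]; first exact: gen_act_linear.
  have jn := ltn_trans ji ik; have [xy xx _] := comm _ _ (ne j jn ji).1.
  by split=> v; rewrite /= !gen_actE !scalerA ?xy ?xx.
- split=> [|j ji]; first exact: gen_act_linear.
  have jn := ltn_trans ji ik; have [_ _ yy] := comm _ _ (ne j jn ji).1.
  have [xy _ _] := comm (Ordinal jn) (Ordinal ik) (ne j jn ji).2.
  by split=> v; rewrite /= !gen_actE !scalerA ?yy ?xy.
by move=> v; rewrite /= !gen_actE scalerA rel scale1r.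
Qed.
End Restriction.

(** The elements of [A] whose action commutes with [f] form a subalgebra containing the
    generators. *)
Lemma hom_linear (V W : lmodType A) (f : V -> W) :
  hom n (f : rep_of V -> rep_of W) <-> linear f.
Proof.
split=> [hf|lf]; last first.
  have [_ fD _ fZ] := linear_morphism lf.
  split=> [a u v|i ik]; first exact: lf.
  by split=> v; rewrite /= !gen_actE; exact: fZ.
pose S : {pred A} := fun a => `[< forall v, f (a *: v) = a *: f v >].
have fD : forall u v, f (u + v) = f u + f v := homD hf.
suff fA a v : f (a *: v) = a *: f v by move=> a u v; rewrite fD fA.
have SE b : b \in S <-> forall v, f (b *: v) = b *: f v by split=> /asboolP.
have clS : subalg_closed S.
  split=> [|k b c /SE fb /SE fc|b c /SE fb /SE fc]; apply/SE => u.
  - by rewrite !scale1r.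
  - rewrite !scalerDl fD fc; congr (_ + _).
    have kA (W' : lmodType A) (w : W') : (k *: b) *: w = (k%:A : A) *: (b *: w).
      by rewrite scalerA -scalerAl mul1r.
    by rewrite !kA -fb; exact: (homZ hf).
  - by rewrite -!scalerA fb fc.
have xS i : x i \in S.
  apply/SE => u; have := homX hf (ltn_ord i) u; rewrite /= !gen_actE.
  by have -> : Ordinal (ltn_ord i) = i by apply: val_inj.
have yS i : y i \in S.
  apply/SE => u; have := homY hf (ltn_ord i) u; rewrite /= !gen_actE.
  by have -> : Ordinal (ltn_ord i) = i by apply: val_inj.
by have /SE := Sn_ind hS clS xS yS a.
Qed.

Section ModuleOfAction.
Variables (V : lmodType K) (v0 : V) (nz : v0 != 0) (phi : A -> end_alg nz).
Hypothesis hphi : is_alg_hom phi.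

(* Mentioning [hphi] makes the module structure below a function of the type. *)
Definition action_mod : Type := let _ := hphi in V.
HB.instance Definition _ := GRing.Zmodule.copy action_mod V.
Definition action_scale (a : A) (v : action_mod) : action_mod := (phi a : lin_end V) v.
Lemma action_scaleA a b v : action_scale a (action_scale b v) = action_scale (a * b) v.
Proof. by have [_ phiM _ _] := hphi; rewrite /action_scale phiM. Qed.
Lemma action_scale1 : left_id 1 action_scale.
Proof. by have [_ _ phi1 _] := hphi; move=> v; rewrite /action_scale phi1. Qed.
Lemma action_scaleDr : right_distributive action_scale +%R.
Proof.
by move=> a u v; have [_ fD _ _] := linear_morphism (lin_end_linear (phi a)); exact: fD.
Qed.
Lemma action_scaleDl v : {morph action_scale^~ v : a b / a + b}.
Proof. by have [phiD _ _ _] := hphi; move=> a b; rewrite /action_scale phiD. Qed.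
HB.instance Definition _ := GRing.Zmodule_isLmodule.Build A action_mod
  action_scaleA action_scale1 action_scaleDr action_scaleDl.

Lemma action_modE (a : A) (v : action_mod) : a *: v = (phi a : lin_end V) v.
Proof. by []. Qed.
End ModuleOfAction.

(** The operators satisfy the relations in the endomorphism algebra of [N], so the universal
    property yields an action of [A]. The zero space is treated apart because [end_alg] asks for a
    nonzero vector. *)
Lemma rep_is_module (N : rep K) : is_rep n N -> exists (V : lmodType A)
  (f : N -> rep_of V) (g : rep_of V -> N), [/\ hom n f, hom n g, cancel f g & cancel g f].
Proof.
move=> rN; have [[v0 /eqP nz]|N0] := pselect (exists v0 : N, v0 <> 0); last first.
  have {}N0 (v : N) : v = 0 by apply: contrapT => v0; apply: N0; exists v.
  pose O : lmodType A := 'rV[A]_0.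
  have O0 (u v : rep_of O) : u = v by apply/rowP => -[].
  exists O, (fun _ => 0), (fun _ => 0); split=> [||v|v]; last 2 first.
  - by rewrite (N0 v).
  - exact: O0.
  - by apply: hom_zero; exact: rep_of_is_rep.
  - exact: hom_zero.
have linx (i : 'I_n) : @opx _ N i \in @lin_pred K N.
  by apply/asboolP; have [[lx _] _ _] := rN i (ltn_ord i).
have liny (i : 'I_n) : @opy _ N i \in @lin_pred K N.
  by apply/asboolP; have [_ [ly _] _] := rN i (ltn_ord i).
pose ex i : end_alg nz := LinEnd (linx i); pose ey i : end_alg nz := LinEnd (liny i).
have rel : Sn_relations ex ey.
  split=> [i|i j ij]; first by apply: lin_endP; have [_ _] := rN i (ltn_ord i).
  have : (i != j :> nat) by [].
  (* [is_rep] makes each operator commute with those of smaller index, hence the split on the order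
     of [i] and [j]. *)
  rewrite neq_ltn => /orP[ltij|ltji].
    have [hx hy _] := rN j (ltn_ord j).
    split; apply: lin_endP => v; [exact: esym (homX hy ltij v)
      |exact: esym (homX hx ltij v)|exact: esym (homY hy ltij v)].
  have [hx hy _] := rN i (ltn_ord i).
  by split; apply: lin_endP => v; [exact: (homY hx ltji v)
    |exact: (homX hx ltji v)|exact: (homY hy ltji v)].
have [[phi [hphi [phix phiy]]] _] := hS.2 (end_alg nz) ex ey rel.
pose V : lmodType A := action_mod hphi.
have f_hom : hom n (id : N -> rep_of V).
  split=> [a u v|i ik]; last first.
    by split=> v; rewrite /= gen_actE action_modE ?phix ?phiy.
  congr (_ + _); rewrite rep_of_scale action_modE.
  by have [_ _ phi1 phiZ] := hphi; rewrite phiZ phi1.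
exists V, id, id; split=> //.
split=> [a u v|i ik]; first by have := f_hom.1 a u v.
by split=> v; [have := homX f_hom ik v | have := homY f_hom ik v].
Qed.

(** Lifting problems correspond because [rep_of] is full by [hom_linear] and essentially surjective
    by [rep_is_module]. *)
Lemma kproj_rep_of (P : lmodType A) : kproj n (rep_of P) <-> projective_mod P.
Proof.
split=> pP.
  move=> M N g h sg.
  have hg : hom n (g : rep_of M -> rep_of N) by apply/hom_linear; exact: linearP.
  have hh : hom n (h : rep_of P -> rep_of N) by apply/hom_linear; exact: linearP.
  have [u [/hom_linear hu gu]] := pP _ _ _ _ (rep_of_is_rep M) (rep_of_is_rep N) hg sg hh.
  by have [h' h'E] := linear_bundle hu; exists h' => p; rewrite h'E; exact: gu.
move=> M N g h rM rN hg sg hh.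
have [M' [f [f' [hf hf' fK f'K]]]] := rep_is_module rM.
have [N' [e [e' [he he' eK e'K]]]] := rep_is_module rN.
have [G GE] := linear_bundle ((hom_linear _).1 (hom_comp hf' (hom_comp hg he))).
have [H HE] := linear_bundle ((hom_linear _).1 (hom_comp hh he)).
have [|h' h'E] := pP _ _ G H.
  move=> v; have [u gu] := sg (e' v); exists (f u).
  by rewrite GE /= fK gu e'K.
exists (f' \o h'); split.
  by apply: hom_comp hf'; apply/hom_linear; exact: linearP.
move=> v; have := h'E v; rewrite GE HE /= => /(congr1 e').
by rewrite !eK.
Qed.

Lemma ses_ker (P M : lmodType A) (f : {linear P -> M}) : surj f ->
  ses n (@ker_val _ _ _ f : rep_of (ker_mod f) -> rep_of P) (f : rep_of P -> rep_of M).
Proof.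
move=> sf; split=> [||||u]; last exact: (ker_exact f u).
- by apply/hom_linear; exact: ker_val_linear.
- by apply/hom_linear; exact: linearP.
- exact: ker_val_inj.
- exact: sf.
Qed.

Lemma pd_le_of_pdim_le d (M : lmodType A) : pdim_le M d -> pd_le n d (rep_of M).
Proof.
elim: d M => [|d IH] M.
  move=> [P [dd [eps [pP P0 epsS ex0 _]]]].
  have [s sE] := choice epsS.
  (* As [P 1 = 0], the augmentation is bijective with inverse [s]. *)
  have eps_inj : injective eps.
    move=> u v e; apply/eqP; rewrite -subr_eq0; apply/eqP.
    have /ex0[q <-] : eps (u - v) = 0 by rewrite linearB /= e subrr.
    by rewrite (P0 1%N isT q) linear0.
  have he : hom n (eps : rep_of (P 0%N) -> rep_of M) by apply/hom_linear; exact: linearP.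
  apply: (kproj_retract (s := (s : rep_of M -> rep_of (P 0%N))) he _ sE); last exact/kproj_rep_of.
  by apply/hom_linear => a u v; apply: eps_inj; rewrite linearP !sE.
move=> /pdim_leS_inv[P [f [pP sf /IH pZ]]].
exists (rep_of P), (rep_of (ker_mod f)), (@ker_val _ _ _ f), f; split=> //.
- exact: rep_of_is_rep.
- exact: rep_of_is_rep.
- exact: ses_ker.
- exact/kproj_rep_of.
Qed.

(** Each syzygy becomes projective over one more pair of generators, so the [e]-th one is projective
    over [A]. *)
Lemma pdim_le_of_kproj k e (M : lmodType A) : (k + e)%N = n ->
  kproj k (rep_of M) -> pdim_le M e.
Proof.
elim: e k M => [|e IH] k M; rewrite ?addn0 => ken pM.
  by apply: pdim_le0; apply/kproj_rep_of; rewrite -ken.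
have kn : (k < n)%N by rewrite -ken addnS ltnS leq_addr.
have [F [p [pF sp]]] := enough_projectives M.
apply: (pdim_leS pF sp); apply: (IH k.+1); first by rewrite addSn -addnS.
have rep_k (V : lmodType A) : is_rep k.+1 (rep_of V) := is_repW kn (@rep_of_is_rep V).
have [hj hp ij sj ex] := ses_ker sp.
apply: (kproj_syzygy (rep_k F) (rep_k M)) pM _.
  by split; [exact: homW kn hj|exact: homW kn hp|exact: ij|exact: sj|exact: ex].
by apply: (kproj_restrict_le kn); [exact: rep_of_is_rep|exact/kproj_rep_of].
Qed.

Lemma gldim_Sn : gldim_eq A n.
Proof.
split=> [M|d gd]; first by apply: (pdim_le_of_kproj (add0n n)); exact: kproj0.
(* The trivial module, on which every [y_i] fixes the nonzero vector 1. *)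
pose T : rep K := @Rep K K^o (fun _ v => v) (fun _ v => v).
have rT : is_rep n T by move=> i ik; split=> //; split=> // a u v.
have [V [f [g [hf hg fK gK]]]] := rep_is_module rT.
apply: (pd_le_ge (v := f (1 : K^o))) (rep_of_is_rep V) _ _ (pd_le_of_pdim_le (gd V)).
  by move=> i u ik; rewrite -(gK u) -(homY hf).
by move=> /(congr1 g); rewrite fK (hom0 hg); apply/eqP; exact: oner_neq0.
Qed.

End ModulesAsReps.

Theorem theorem6p8 (K : fieldType) (n : nat) (A : algType K)
    (x y : 'I_n -> A) :
  (0 < n)%N -> is_Sn x y ->
  l_gldim_eq A n /\ r_gldim_eq A n.
Proof.
move=> _ hS; split; first exact: gldim_Sn hS.
exact: gldim_Sn (is_Sn_converse hS).
Qed.
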